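(* For each of the following six choices of formal power series $b_j(q)$ $(j\ge1)$, $c_d(q)$ $(d\ge1)$ and $G(q)$, the identity of formal power series in $q$ $$\sum_{N=0}^\infty\left[\prod_{j=1}^\infty b_j(q)-\prod_{j=1}^N b_j(q)\right]=\prod_{j=1}^\infty b_j(q)\sum_{d=1}^\infty c_d(q)+G(q)$$ holds: (i) $b_j(q)=\dfrac{1}{1-q^j}$, $c_d(q)=\dfrac{q^d}{1-q^d}$, $G(q)=0$; (ii) $b_j(q)=\dfrac{1+q^j}{1-q^j}$, $c_d(q)=\dfrac{2q^d}{1-q^{2d}}$, $G(q)=0$; (iii) $b_j(q)=\dfrac{1-q^{2j-1}}{1-q^{2j}}$, $c_d(q)=\dfrac{(-1)^dq^d}{1-q^d}$, $G(q)=0$; (iv) $b_j(q)=1-q^j$, $c_d(q)=\dfrac{q^d}{1-q^d}$, $G(q)=\sum_{r=1}^\infty(-1)^r\left[(3r-1)q^{r(3r-1)/2}+3r\,q^{r(3r+1)/2}\right]$; (v) $b_j(q)=\dfrac{1-q^j}{1+q^j}$, $c_d(q)=\dfrac{2q^d}{1-q^{2d}}$, $G(q)=4\sum_{r=1}^\infty(-1)^r r\,q^{r^2}$; (vi) $b_j(q)=\dfrac{1-q^{2j}}{1-q^{2j+1}}$, $c_d(q)=\dfrac{(-1)^dq^d}{1-q^d}$, $G(q)=(1-q)\sum_{r=1}^\infty r\,q^{r(r+1)/2}$.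
   Context: All series are formal power series in $q$ with integer coefficients; rational expressions such as $1/(1-q^j)$ denote their power series expansions. An empty product equals $1$. Infinite sums and products are understood as $q$-adic limits (in each case $b_j(q)\to1$ and $c_d(q)\to0$ $q$-adically). *)

(* Defs.v *)
From HB Require Import structures.
From mathcomp Require Import all_boot all_order all_algebra.
From mathcomp Require Import boolp classical_sets filter.
From mathcomp Require Import topology sequences.

Set Implicit Arguments.
Unset Strict Implicit.
Unset Printing Implicit Defensive.

Import Order.TTheory GRing.Theory Num.Theory.
Local Open Scope classical_set_scope.
Local Open Scope ring_scope.

(* Z[[q]]; a record rather than the bare type nat -> int, because the latter
   already carries the pointwise product. *)
Record fps := Fps { coef_fps : nat -> int }.

Coercion coef_fps : fps >-> Funclass.

Lemma fpsP (f g : fps) : f =1 g <-> f = g.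
Proof.
split=> [|->//]; case: f => f; case: g => g /= fg; congr Fps.
exact/funext.
Qed.

HB.instance Definition _ := gen_eqMixin fps.
HB.instance Definition _ := gen_choiceMixin fps.

Section Ring.
Implicit Types f g h : fps.

Definition fps0 := Fps (fun=> 0).
Definition fps1 := Fps (fun n => (n == 0%N)%:R).
Definition fps_opp f := Fps (fun n => - f n).
Definition fps_add f g := Fps (fun n => f n + g n).
Definition fps_mul f g := Fps (fun n => \sum_(i < n.+1) f i * g (n - i)%N).

Let addA : associative fps_add.
Proof. by move=> f g h; apply/fpsP => n /=; rewrite addrA. Qed.
Let addC : commutative fps_add.
Proof. by move=> f g; apply/fpsP => n /=; rewrite addrC. Qed.
Let add0 : left_id fps0 fps_add.
Proof. by move=> f; apply/fpsP => n /=; rewrite add0r. Qed.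
Let addN : left_inverse fps0 fps_opp fps_add.
Proof. by move=> f; apply/fpsP => n /=; rewrite addNr. Qed.

HB.instance Definition _ := GRing.isZmodule.Build fps addA addC add0 addN.

Let trunc n f : {poly int} := \poly_(i < n.+1) f i.

Let coef_trunc n f k : (k <= n)%N -> (trunc n f)`_k = f k.
Proof. by move=> kn; rewrite coef_poly ltnS kn. Qed.

Let coef_mul_trunc n f g k : (k <= n)%N ->
  fps_mul f g k = (trunc n f * trunc n g)`_k.
Proof.
move=> kn; rewrite coefM; apply: eq_bigr => i _.
have ik : (i <= k)%N by rewrite -ltnS.
by rewrite !coef_trunc ?(leq_trans _ kn) ?leq_subr.
Qed.

Let mulA : associative fps_mul.
Proof.
move=> f g h; apply/fpsP => n.
transitivity ((trunc n f * (trunc n g * trunc n h))`_n).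
  rewrite coefM; apply: eq_bigr => i _.
  have ik : (i <= n)%N by rewrite -ltnS.
  by rewrite coef_trunc// (@coef_mul_trunc n) ?leq_subr.
rewrite mulrA coefM; apply: eq_bigr => i _.
have ik : (i <= n)%N by rewrite -ltnS.
by rewrite (@coef_mul_trunc n)// coef_trunc ?leq_subr.
Qed.
Let mulC : commutative fps_mul.
Proof.
by move=> f g; apply/fpsP => n; rewrite !(@coef_mul_trunc n)// mulrC.
Qed.
Let mul1 : left_id fps1 fps_mul.
Proof.
move=> f; apply/fpsP => n /=.
rewrite big_ord_recl /= mul1r subn0 big1 ?addr0// => i _.
by rewrite mul0r.
Qed.
Let mulDl : left_distributive fps_mul fps_add.
Proof.
move=> f g h; apply/fpsP => n /=.
by rewrite -big_split; apply: eq_bigr => i _; rewrite mulrDl.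
Qed.
Let one_neq0 : fps1 != 0.
Proof. by apply/eqP => /fpsP /(_ 0%N). Qed.

HB.instance Definition _ :=
  GRing.Zmodule_isComNzRing.Build fps mulA mulC mul1 mulDl one_neq0.

Lemma coef_fps0 n : (0 : fps) n = 0. Proof. by []. Qed.
Lemma coef_fps1 n : (1 : fps) n = (n == 0%N)%:R. Proof. by []. Qed.
Lemma coef_fpsN f n : (- f) n = - f n. Proof. by []. Qed.
Lemma coef_fpsD f g n : (f + g) n = f n + g n. Proof. by []. Qed.
Lemma coef_fpsB f g n : (f - g) n = f n - g n. Proof. by []. Qed.
Lemma coef_fpsM f g n : (f * g) n = \sum_(i < n.+1) f i * g (n - i)%N.
Proof. by []. Qed.
Lemma coef_fps_sum I (r : seq I) (P : pred I) (F : I -> fps) n :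
  (\sum_(i <- r | P i) F i) n = \sum_(i <- r | P i) F i n.
Proof. exact: (big_morph (fun f : fps => f n)). Qed.

Lemma coef_fpsX_lt f k n : f 0%N = 0 -> (n < k)%N -> (f ^+ k) n = 0.
Proof.
move=> f0; elim: k n => [//|k IH] n nk; rewrite exprS coef_fpsM big1 // => i _.
case: (posnP i) => [->|i0]; first by rewrite f0 mul0r.
have nik : (n - i < k)%N.
  rewrite -(ltn_add2r i) subnK -1?ltnS//; apply: leq_ltn_trans nk _.
  by rewrite -[ltnLHS]addn0 ltn_add2l.
by rewrite IH ?mulr0.
Qed.

(* A series whose constant term u is a unit of Z (so that u^-1 = u) is
   u * (1 - h) with h 0 = 0, and its inverse is u * \sum_k h ^+ k. *)
Definition fps_inv f : fps :=
  if f 0%N \is a GRing.unit then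
    let u : fps := (f 0%N)%:~R in
    u * Fps (fun n => (\sum_(k < n.+1) (1 - u * f) ^+ k) n)
  else f.

Let coef0M f g : (f * g) 0%N = f 0%N * g 0%N.
Proof. by rewrite coef_fpsM big_ord1. Qed.

Let coef0_intr (z : int) : (z%:~R : fps) 0%N = z.
Proof.
have natE m : (m%:R : fps) 0%N = m%:Z.
  elim: m => // m IH; rewrite mulrS coef_fpsD IH coef_fps1 -[in RHS]addn1.
  by rewrite PoszD addrC.
case: z => m; first exact: natE.
by rewrite NegzE mulrNz coef_fpsN -pmulrn natE.
Qed.

Let mulVx :
  {in [pred f : fps | f 0%N \is a GRing.unit], left_inverse 1 fps_inv *%R}.
Proof.
move=> f; rewrite inE => Uf; rewrite /fps_inv Uf.
set u : fps := _%:~R; set h := 1 - u * f; set S := Fps _.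
have f0 : f 0%N * f 0%N = 1 by case/orP: Uf => /eqP ->.
have h0 : h 0%N = 0 by rewrite coef_fpsB coef_fps1 coef0M coef0_intr f0 subrr.
rewrite [u * S]mulrC -mulrA -[u * f](subKr 1) -/h mulrC.
apply/fpsP => n.
have coefS k : (k <= n)%N -> S k = (\sum_(j < n.+1) h ^+ j) k.
  move=> kn; rewrite /= !coef_fps_sum.
  rewrite -(big_mkord xpredT (fun j => (h ^+ j) k)).
  rewrite -(big_mkord xpredT (fun j => (h ^+ j) k)).
  rewrite [RHS](big_cat_nat (n := k.+1))//= [X in _ + X]big_nat_cond.
  rewrite [X in _ + X]big1 ?addr0// => j /andP[/andP[kj _] _].
  exact: coef_fpsX_lt.
transitivity (((1 - h) * \sum_(j < n.+1) h ^+ j) n).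
  by rewrite !coef_fpsM; apply: eq_bigr => i _; rewrite coefS ?leq_subr.
by rewrite -opprB mulNr -subrX1 opprB coef_fpsB (coef_fpsX_lt h0)// subr0.
Qed.

Let unitPl f g : g * f = 1 -> f 0%N \is a GRing.unit.
Proof.
move=> /fpsP/(_ 0%N); rewrite coef0M coef_fps1 => gf.
by apply/unitrPr; exists (g 0%N); rewrite mulrC.
Qed.

Let inv_out :
  {in [predC [pred f : fps | f 0%N \is a GRing.unit]], fps_inv =1 id}.
Proof. by move=> f; rewrite !inE /fps_inv => /negbTE ->. Qed.

HB.instance Definition _ :=
  GRing.ComNzRing_hasMulInverse.Build fps mulVx unitPl inv_out.

Lemma fps_unitE f : (f \is a GRing.unit) = (f 0%N \is a GRing.unit).
Proof. by []. Qed.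

End Ring.

Definition q : fps := Fps (fun n => (n == 1%N)%:R).

(* The q-adic topology: the sets f + q^n Z[[q]] form a basis of neighbourhoods
   of f. *)
Definition fps_nbhs (f : fps) : set_system fps :=
  [set A | exists n, [set g : fps | forall i, (i < n)%N -> g i = f i] `<=` A].

HB.instance Definition _ := hasNbhs.Build fps fps_nbhs.
HB.instance Definition _ := isPointed.Build fps 0.

Section Topology.

Let nbhs_filter (f : fps) : ProperFilter (nbhs f).
Proof.
split; first by move=> [n /(_ f)]; apply.
split; first by exists 0%N.
- move=> A B [m mA] [n nB]; exists (maxn m n) => g gf; split.
    by apply: mA => i im; apply: gf; rewrite leq_max im.
  by apply: nB => i im; apply: gf; rewrite leq_max im orbT.
- by move=> A B AB [n nA]; exists n => g /nA /AB.
Qed.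

Let nbhs_singleton (f : fps) (A : set fps) : nbhs f A -> A f.
Proof. by move=> [n]; apply. Qed.

Let nbhs_nbhs (f : fps) (A : set fps) : nbhs f A -> nbhs f (nbhs^~ A).
Proof.
move=> [n nA]; exists n => g gf; exists n => h hg.
by apply: nA => i im; rewrite hg// gf.
Qed.

HB.instance Definition _ :=
  Nbhs_isNbhsTopological.Build fps nbhs_filter nbhs_singleton nbhs_nbhs.

End Topology.

Lemma fps_hausdorff : hausdorff_space fps.
Proof.
move=> f g fg; apply/fpsP => n.
have [||h [hf hg]] := fg [set h : fps | h n = f n] [set h : fps | h n = g n].
- by exists n.+1 => h; apply.
- by exists n.+1 => h; apply.
- by rewrite -hf.
Qed.

Lemma fps_cvgP (u : nat -> fps) (l : fps) :
  u @ \oo --> l <-> forall n, exists M, forall N, (M <= N)%N -> u N n = l n.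
Proof.
split=> [ul n|ul A [n nA]].
  have /ul[M _ MP] : nbhs l [set g : fps | g n = l n] by exists n.+1 => h; apply.
  by exists M => N; apply: MP.
have [M MP] : exists M, forall i N, (i < n)%N -> (M <= N)%N -> u N i = l i.
  elim: n {nA} => [|n [M1 H1]]; first by exists 0%N.
  have [M2 H2] := ul n; exists (maxn M1 M2) => i N.
  rewrite ltnS leq_eqVlt geq_max => /orP[/eqP->|ni] /andP[? ?]; last exact: H1.
  exact: H2.
by exists M => // N MN; apply: nA => i ni; apply: MP.
Qed.

Reserved Notation "\prod_ ( m <= i '<oo' ) F"
  (F at level 36,
   format "'[' \prod_ ( m  <=  i  <oo ) '/  '  F ']'").

Notation "\sum_ ( m <= i <oo ) F" :=
  (\big[+%R/0%R]_(m <= i <oo) F%R) : ring_scope.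
Notation "\prod_ ( m <= i <oo ) F" :=
  (\big[*%R/1%R]_(m <= i <oo) F%R) : ring_scope.

Definition summable_from (m : nat) (a : nat -> fps) : Prop :=
  cvgn (fun n => \sum_(m <= i < n) a i).

Definition multipliable_from (m : nat) (a : nat -> fps) : Prop :=
  cvgn (fun n => \prod_(m <= i < n) a i).

Definition tail (b : nat -> fps) (N : nat) : fps :=
  \prod_(1 <= j <oo) b j - \prod_(1 <= j < N.+1) b j.

(* lim is a total operator, so the convergence of the three infinite sums and
   products in the identity is stated along with it. *)
Definition tail_identity (b c : nat -> fps) (G : fps) : Prop :=
  [/\ multipliable_from 1 b,
      summable_from 1 c,
      summable_from 0 (tail b) &
      \sum_(0 <= N <oo) tail b N
        = (\prod_(1 <= j <oo) b j) * (\sum_(1 <= d <oo) c d) + G].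

(* Main.v *)
Require Import Defs.
From HB Require Import structures.
From mathcomp Require Import all_boot all_order all_algebra.
From mathcomp Require Import boolp classical_sets filter.
From mathcomp Require Import topology sequences.
From mathcomp Require Import ring zify.

(* For B_n(x) deforming B_n = b_1 ... b_n, the derivative at x = 1 of
   (1 - x) \sum_{n < M} x^n B_n(x) + x^M B_M(x) is
   M B_M - \sum_{n < M} B_n + B_M'(1), i.e. the M-th partial sum of tails plus
   the derivative of a product. In cases (i)-(iii) B_n does not depend on x and
   the q-binomial theorem evaluates the expression as a product, whose
   logarithmic derivative is \sum_d c_d. In cases (iv)-(vi),
   B_n(x) = \prod_{i <= n} (1 - x p^i) / (1 - beta x p^i), the logarithmic
   derivative of B_M(x) is - \sum_d c_d (up to one term in case (vi)), and the
   Rogers-Fine identity evaluates the expression as a partial theta series,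
   whose derivative is G. Both identities are proved modulo p^M for finite sums
   in an arbitrary commutative ring, and applied at x = 1 + eps in the ring of
   dual numbers over Z[[q]], so that no limit in x is taken. *)

Set Implicit Arguments.
Unset Strict Implicit.

Import GRing.Theory.
Local Open Scope ring_scope.

(** * Congruences *)

(** Congruence modulo the principal ideal of [u], with an explicit cofactor so that [ring] can check
    each witness. *)
Definition eqmod (K : comPzRingType) (u a b : K) := exists c, a = b + u * c.

Section EqMod.
Variables (K : comPzRingType) (u : K).
Implicit Types a b c d : K.

Lemma eqmod_refl a : eqmod u a a.
Proof. by exists 0; ring. Qed.

Lemma eqmod_sym a b : eqmod u a b -> eqmod u b a.
Proof. by case=> c ->; exists (- c); ring. Qed.

Lemma eqmod_trans b a c : eqmod u a b -> eqmod u b c -> eqmod u a c.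
Proof. by move=> [d ->] [e ->]; exists (d + e); ring. Qed.

Lemma eqmodD a b c d : eqmod u a b -> eqmod u c d -> eqmod u (a + c) (b + d).
Proof. by move=> [e ->] [f ->]; exists (e + f); ring. Qed.

Lemma eqmodN a b : eqmod u a b -> eqmod u (- a) (- b).
Proof. by move=> [e ->]; exists (- e); ring. Qed.

Lemma eqmodM a b c d : eqmod u a b -> eqmod u c d -> eqmod u (a * c) (b * d).
Proof. by move=> [e ->] [f ->]; exists (e * d + b * f + u * e * f); ring. Qed.

Lemma eqmodMl a b c : eqmod u a b -> eqmod u (c * a) (c * b).
Proof. exact/eqmodM/eqmod_refl. Qed.

Lemma eqmod_sum (I : Type) (r : seq I) (F G : I -> K) :
  (forall i, eqmod u (F i) (G i)) ->
  eqmod u (\sum_(i <- r) F i) (\sum_(i <- r) G i).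
Proof.
move=> FG; elim: r => [|i r IH]; first by rewrite !big_nil; exact: eqmod_refl.
by rewrite !big_cons; apply: eqmodD.
Qed.

Lemma eqmod0M a : eqmod u (u * a) 0.
Proof. by exists a; ring. Qed.

End EqMod.

Lemma eqmod1 (K : comPzRingType) (a b : K) : eqmod 1 a b.
Proof. by exists (a - b); ring. Qed.

Lemma eqmod_weak (K : comPzRingType) (u v a b : K) :
  eqmod (u * v) a b -> eqmod u a b.
Proof. by case=> c ->; exists (v * c); ring. Qed.

Lemma eqmod_exp_leq (K : comPzRingType) (u a b : K) m n :
  (m <= n)%N -> eqmod (u ^+ n) a b -> eqmod (u ^+ m) a b.
Proof. by move=> /subnKC <-; rewrite exprD; apply: eqmod_weak. Qed.

Lemma eqmodX0 (K : comPzRingType) (u a : K) m n :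
  (m <= n)%N -> eqmod (u ^+ m) (u ^+ n * a) 0.
Proof. by move=> mn; apply: eqmod_exp_leq mn (eqmod0M _ _). Qed.

Lemma eqmod_div1 (R : comUnitRingType) (u f g : R) :
  g \is a GRing.unit -> eqmod u f g -> eqmod u (f / g) 1.
Proof. by move=> ug [c ->]; exists (c / g); rewrite mulrDl divrr // mulrA. Qed.

Lemma eqmod_1B (R : comPzRingType) (u a : R) : eqmod u (1 - u * a) 1.
Proof. by exists (- a); ring. Qed.

(** * The q-binomial theorem modulo [p ^+ M] *)

Section QBinomial.
Variables (K : comUnitRingType) (p alpha : K).
Hypothesis p_unit : forall j, 1 - p ^+ j.+1 \is a GRing.unit.

(** In Pochhammer notation, [(alpha; p)_n / (p; p)_n]. *)
Let u n := \prod_(i < n) ((1 - alpha * p ^+ i) / (1 - p ^+ i.+1)).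

Let f M y := \sum_(n < M) u n * y ^+ n.

(** The full series satisfies [(1 - y) * f y = (1 - alpha * y) * f (y * p)]; the extra term is the
    defect caused by truncating at [M]. *)
Lemma qbinomial_shift M y :
  (1 - y) * f M y + u M * (1 - p ^+ M) * y ^+ M = (1 - alpha * y) * f M (y * p).
Proof.
rewrite /f; elim: M => [|M IH]; first by rewrite !big_ord0 expr0; ring.
have uS : u M.+1 * (1 - p ^+ M.+1) = u M * (1 - alpha * p ^+ M).
  by rewrite /u big_ord_recr /= -!mulrA mulVr ?mulr1.
rewrite !big_ord_recr /= uS mulrDr [RHS]mulrDr -IH exprMn exprS; ring.
Qed.

(** Each use of the shift splits off one factor of the product, with a defect divisible by [p ^+ M].
    After enough shifts only the constant term 1 of the series survives modulo [p ^+ M]. *)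
Lemma qbinomial_mod (x : K) M :
  (forall j, 1 - x * p ^+ j.+1 \is a GRing.unit) ->
  eqmod (p ^+ M) ((1 - x) * (\sum_(n < M) u n * x ^+ n) + u M * x ^+ M)
    (\prod_(i < M) ((1 - alpha * (x * p ^+ i)) / (1 - x * p ^+ i.+1))).
Proof.
move=> x_unit.
pose P k := \prod_(i < k) ((1 - alpha * (x * p ^+ i)) / (1 - x * p ^+ i.+1)).
rewrite -/(P M) -/(f M x).
have step k : eqmod (p ^+ M) ((1 - x) * f M x + u M * x ^+ M)
    (P k * (1 - alpha * (x * p ^+ k)) * f M (x * p ^+ k.+1)).
  elim: k => [|k IH].
    rewrite /P big_ord0 mul1r expr0 mulr1 expr1 -qbinomial_shift.
    (* The first boundary term has no factor [p ^+ M] from [x ^+ M], so it stays on the left; only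
       its [1 - p ^+ M] is replaced by 1. *)
    by exists (u M * x ^+ M); ring.
  apply: eqmod_trans IH _.
  set y := x * p ^+ k.+1.
  have -> : x * p ^+ k.+2 = y * p by rewrite /y exprSr mulrA.
  rewrite /P big_ord_recr /= -/(P k) -/y -!mulrA.
  do 2!apply: eqmodMl.
  rewrite [x * (_ * p)]mulrA -/y -qbinomial_shift mulrDr mulKr ?x_unit //.
  (* From here on the defect contains [y ^+ M], hence a factor [p ^+ M]. *)
  exists (- ((1 - y)^-1 * (u M * (1 - p ^+ M) * (x ^+ M * (p ^+ M) ^+ k)))).
  have -> : y ^+ M = x ^+ M * (p ^+ M * (p ^+ M) ^+ k).
    rewrite /y exprMn (exprAC p k.+1) [_ ^+ k.+1]exprS. by [].
  ring.
apply: eqmod_trans (step M) _; rewrite -[X in eqmod _ _ X]mulr1 -mulrA.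
apply: eqmodMl; rewrite -[X in eqmod _ _ X]mulr1; apply: eqmodM.
  by exists (- (alpha * x)); ring.
(* For [M = 0] the truncated series is empty and has no constant term, but the modulus is 1. *)
case: M {step} => [|M]; first by rewrite expr0; apply: eqmod1.
rewrite /f big_ord_recl /u big_ord0 expr0 mulr1 -[X in eqmod _ _ X]addr0.
apply: eqmodD; first exact: eqmod_refl.
rewrite -[X in eqmod _ _ X](_ : \sum_(i < M) 0 = 0); last exact: big1.
apply: eqmod_sum => i; rewrite lift0 !exprS.
set v := \prod_(_ < _) _.
exists (v * (x * p * (x * (p * p ^+ M.+1)) ^+ i)); rewrite exprS; ring.
Qed.

End QBinomial.

(** * The Rogers-Fine identity modulo [p ^+ M] *)

Section RogersFine.
Variables (K : comUnitRingType) (p beta : K).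

Let w y n :=
  y ^+ n * \prod_(i < n) ((1 - y * p ^+ i.+1) / (1 - beta * (y * p ^+ i.+1))).

(* Fine's F(a, b; t) at a = t = y and b = beta y; the summand of the difference
   of the two sums is the increment of (y^2 p^(n+1) - 1) w y n. *)
Lemma rogers_fine_shift M y :
  (forall j, 1 - beta * (y * p ^+ j.+1) \is a GRing.unit) ->
  (1 - y) * (\sum_(n < M) w y n) + (1 - y ^+ 2 * p ^+ M.+1) * w y M =
  1 - y ^+ 2 * p + (beta - y * p) / (1 - beta * (y * p)) * y ^+ 2 * p *
    ((1 - y * p) * \sum_(n < M) w (y * p) n).
Proof.
move=> y_unit; elim: M => [|M IH].
  by rewrite !big_ord0 /w big_ord0; ring.
have wS : w y M.+1 * (1 - beta * (y * p ^+ M.+1)) = w y M * y * (1 - y * p ^+ M.+1).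
  by rewrite /w big_ord_recr /= exprSr -!mulrA mulVr ?mulr1 ?y_unit //; ring.
(* Shifting [y] to [y * p] loses the first factor of the product; the prefactor restores it. *)
have wp : y * (1 - y * p) / (1 - beta * (y * p)) * w (y * p) M = p ^+ M * w y M.+1.
  rewrite /w big_ord_recl expr1 exprMn.
  under eq_bigr => i _ do rewrite -[y * p * _]mulrA -exprS.
  under [in RHS]eq_bigr => i _ do rewrite lift0.
  by rewrite exprS; ring.
rewrite !big_ord_recr /= !mulrDr addrA -IH.
have -> : (beta - y * p) / (1 - beta * (y * p)) * y ^+ 2 * p *
    ((1 - y * p) * w (y * p) M) =
    (beta - y * p) * y * p * (p ^+ M * w y M.+1).
  by rewrite -wp; ring.
apply/eqP; rewrite -subr_eq0; apply/eqP.
rewrite [LHS](_ : _ = w y M.+1 * (1 - beta * (y * p ^+ M.+1))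
   - w y M * y * (1 - y * p ^+ M.+1)); first by rewrite wS subrr.
by rewrite !exprS; ring.
Qed.

(** The shift is iterated from [x] to [x * p ^+ M]. The accumulated coefficient [t k] has exponent
    [k ^ 2], a sum of odd numbers, so the remainder [t M * R M] is divisible by [p ^+ (M ^ 2)]. *)
Lemma rogers_fine_mod (x : K) M :
  (forall j, 1 - beta * (x * p ^+ j.+1) \is a GRing.unit) ->
  eqmod (p ^+ M) ((1 - x) * (\sum_(n < M) w x n) + w x M)
    (\sum_(n < M)
       (\prod_(j < n) ((beta - x * p ^+ j.+1) / (1 - beta * (x * p ^+ j.+1)))) *
       (x ^+ (2 * n) * p ^+ (n ^ 2) * (1 - x ^+ 2 * p ^+ (2 * n).+1))).
Proof.
move=> x_unit.
pose R k := (1 - x * p ^+ k) * (\sum_(n < M) w (x * p ^+ k) n) + w (x * p ^+ k) M.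
pose P k := \prod_(j < k) ((beta - x * p ^+ j.+1) / (1 - beta * (x * p ^+ j.+1))).
pose t k := P k * (x ^+ (2 * k) * p ^+ (k ^ 2)).
have step k : eqmod (p ^+ M) (R k) (1 - x ^+ 2 * p ^+ (2 * k).+1 +
    (beta - x * p ^+ k.+1) / (1 - beta * (x * p ^+ k.+1)) *
    (x ^+ 2 * p ^+ (2 * k).+1) * R k.+1).
  set y := x * p ^+ k.
  have ypE : x * p ^+ k.+1 = y * p by rewrite /y exprSr mulrA.
  have y2pE : x ^+ 2 * p ^+ (2 * k).+1 = y ^+ 2 * p.
    by rewrite /y exprMn [p ^+ _.+1]exprSr mulnC exprM mulrA.
  have y_unit j : 1 - beta * (y * p ^+ j.+1) \is a GRing.unit.
    by rewrite /y -mulrA -exprD addnS.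
  have := rogers_fine_shift M y_unit.
  rewrite /R ypE y2pE -/y => E.
  rewrite [X in eqmod _ X](_ : _ = (1 - y) * \sum_(n < M) w y n
    + (1 - y ^+ 2 * p ^+ M.+1) * w y M + p ^+ M * (y ^+ 2 * p * w y M)); last first.
    by rewrite [p ^+ M.+1]exprS; ring.
  rewrite E; set c := (beta - y * p) / _.
  (* Two discrepancies with the shift are absorbed: its boundary factor [1 - y ^+ 2 * p ^+ M.+1]
     against 1 in [R k], and the boundary term of [R k.+1], which contains [(y * p) ^+ M]. *)
  exists (y ^+ 2 * p * w y M - c * y ^+ 2 * p * (y ^+ M *
    \prod_(i < M) ((1 - y * p * p ^+ i.+1) / (1 - beta * (y * p * p ^+ i.+1))))).
  by rewrite /w (exprMn _ y p); ring.
have all k : eqmod (p ^+ M) (R 0%N)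
    (\sum_(n < k) P n * (x ^+ (2 * n) * p ^+ (n ^ 2) * (1 - x ^+ 2 * p ^+ (2 * n).+1))
     + t k * R k).
  elim: k => [|k IH].
    rewrite big_ord0 /t /P big_ord0 !expr0 add0r !mul1r; exact: eqmod_refl.
  apply: eqmod_trans IH _; rewrite big_ord_recr /= -addrA.
  apply: eqmodD; first exact: eqmod_refl.
  have -> : t k.+1 = t k * ((beta - x * p ^+ k.+1) / (1 - beta * (x * p ^+ k.+1))
      * (x ^+ 2 * p ^+ (2 * k).+1)).
    rewrite /t /P big_ord_recr /= mulnS exprD (_ : k.+1 ^ 2 = k ^ 2 + (2 * k).+1)%N.
      by rewrite exprD; ring.
    by rewrite -[k.+1]addn1 sqrnD; lia.
  have /(eqmodMl (t k)) := step k; congr eqmod; rewrite /t /P; ring.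
have := all M; rewrite {1}/R expr0 mulr1 => allM.
apply: eqmod_trans allM _; rewrite -[X in eqmod _ _ X]addr0.
apply: eqmodD; first exact: eqmod_refl.
apply: (@eqmod_exp_leq _ _ _ _ _ (M ^ 2)).
  by case: (M) => // m; rewrite leq_pmulr.
by exists (P M * x ^+ (2 * M) * R M); rewrite /t; ring.
Qed.
End RogersFine.

(** * Dual numbers *)

(* [Dual a b] stands for a + b eps, where eps^2 = 0. *)
Record dual (R : Type) := Dual { dval : R; dder : R }.

Lemma dual_pairK (R : Type) :
  cancel (fun z : dual R => (dval z, dder z)) (fun z => Dual z.1 z.2).
Proof. by case. Qed.

HB.instance Definition _ (R : choiceType) :=
  Choice.copy (dual R) (can_type (@dual_pairK R)).

Section Dual.
Variable R : comUnitRingType.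
Implicit Types z t : dual R.

Let add z t := Dual (dval z + dval t) (dder z + dder t).
Let opp z := Dual (- dval z) (- dder z).
Let mul z t := Dual (dval z * dval t) (dval z * dder t + dder z * dval t).
Let unit := [pred z : dual R | dval z \is a GRing.unit].
Let inv z :=
  if unit z then Dual (dval z)^-1 (- (dder z / dval z ^+ 2)) else z.

Let addA : associative add.
Proof. by move=> [a b] [c d] [e f]; congr Dual; rewrite /= addrA. Qed.
Let addC : commutative add.
Proof. by move=> [a b] [c d]; congr Dual; rewrite /= addrC. Qed.
Let add0 : left_id (Dual 0 0) add.
Proof. by move=> [a b]; congr Dual; rewrite /= add0r. Qed.
Let addN : left_inverse (Dual 0 0) opp add.
Proof. by move=> [a b]; congr Dual; rewrite /= addNr. Qed.

HB.instance Definition _ := GRing.isZmodule.Build (dual R) addA addC add0 addN.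

Let mulA : associative mul.
Proof. by move=> [a b] [c d] [e f]; congr Dual => /=; ring. Qed.
Let mulC : commutative mul.
Proof. by move=> [a b] [c d]; congr Dual => /=; ring. Qed.
Let mul1 : left_id (Dual 1 0) mul.
Proof. by move=> [a b]; congr Dual => /=; ring. Qed.
Let mulDl : left_distributive mul add.
Proof. by move=> [a b] [c d] [e f]; congr Dual => /=; ring. Qed.
Let one_neq0 : Dual 1 0 != 0 :> dual R.
Proof. by apply/eqP => -[/eqP]; rewrite oner_eq0. Qed.

HB.instance Definition _ :=
  GRing.Zmodule_isComNzRing.Build (dual R) mulA mulC mul1 mulDl one_neq0.

Let mulVx : {in unit, left_inverse 1 inv *%R}.
Proof.
move=> [a b]; rewrite inE /= => ua; rewrite /inv /= ua; congr Dual => /=.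
  exact: mulVr.
by rewrite mulNr expr2 invrM // !mulrA divrK // [a^-1 * b]mulrC subrr.
Qed.
Let unitPl z t : t * z = 1 -> unit z.
Proof. by case=> tz _; apply/unitrPr; exists (dval t); rewrite mulrC. Qed.
Let inv_out : {in [predC unit], inv =1 id}.
Proof. by move=> z; rewrite !inE /inv => /negbTE /= ->. Qed.

HB.instance Definition _ :=
  GRing.ComNzRing_hasMulInverse.Build (dual R) mulVx unitPl inv_out.

Lemma dual_unitE z : (z \is a GRing.unit) = (dval z \is a GRing.unit).
Proof. by []. Qed.

Lemma dvalD z t : dval (z + t) = dval z + dval t. Proof. by []. Qed.
Lemma dderD z t : dder (z + t) = dder z + dder t. Proof. by []. Qed.
Lemma dvalM z t : dval (z * t) = dval z * dval t. Proof. by []. Qed.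
Lemma dderM z t : dder (z * t) = dval z * dder t + dder z * dval t.
Proof. by []. Qed.

Lemma dual_sum I (r : seq I) (F G : I -> R) :
  \sum_(i <- r) Dual (F i) (G i) = Dual (\sum_(i <- r) F i) (\sum_(i <- r) G i).
Proof. by elim/big_rec3: _ => // i x y _ _ ->. Qed.

Definition dconst (a : R) := Dual a 0.

(* [dlog a l] has value [a] and logarithmic derivative [l]. *)
Definition dlog (a l : R) := Dual a (a * l).

Lemma dlog0 a : dconst a = dlog a 0.
Proof. by rewrite /dlog mulr0. Qed.

Lemma dlogM a b l m : dlog a l * dlog b m = dlog (a * b) (l + m).
Proof. by congr Dual => /=; ring. Qed.

Lemma dlogV a l : a \is a GRing.unit -> (dlog a l)^-1 = dlog a^-1 (- l).
Proof.
move=> ua; have uz : dlog a l \is a GRing.unit by rewrite dual_unitE.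
apply: (mulIr uz); rewrite mulVr // dlogM mulVr // addNr /dlog mulr0 //.
Qed.

Lemma dlogX a l n : dlog a l ^+ n = dlog (a ^+ n) (l *+ n).
Proof.
elim: n => [|n IH]; first by rewrite /dlog mulr0.
by rewrite exprS IH dlogM exprS mulrS.
Qed.

Lemma dlog_prod I (r : seq I) (F L : I -> R) :
  \prod_(i <- r) dlog (F i) (L i) = dlog (\prod_(i <- r) F i) (\sum_(i <- r) L i).
Proof.
elim/big_rec3: _ => [|i a l z _ ->]; first by rewrite /dlog mulr0.
by rewrite dlogM.
Qed.

Lemma dconstX a n : dconst a ^+ n = dconst (a ^+ n).
Proof. by rewrite !dlog0 dlogX mul0rn. Qed.

(** Multiplying by a constant acts on each component separately, so a congruence modulo a constant
    may be differentiated. *)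
Lemma eqmod_dual (a : R) z t :
  eqmod (dconst a) z t -> eqmod a (dval z) (dval t) /\ eqmod a (dder z) (dder t).
Proof.
by case=> -[c d] ->; split; [exists c|exists d => /=; rewrite mul0r addr0].
Qed.

End Dual.

(** * Tails of finite products *)

Section Tails.
Variable R : comUnitRingType.
Implicit Types p a g : R.

(* 1 + eps *)
Let x : dual R := dlog 1 1.

Lemma dlog1B g : 1 - g \is a GRing.unit ->
  1 - x * dconst g = dlog (1 - g) (- (g / (1 - g))).
Proof.
by move=> ug; congr Dual => /=; rewrite ?mulrN ?[g / _]mulrC ?mulVKr //; ring.
Qed.

Lemma dlog1B_const g : 1 - dconst g = dlog (1 - g) 0.
Proof. by congr Dual => /=; ring. Qed.

Lemma dconstM a g : dconst a * dconst g = dconst (a * g).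
Proof. by congr Dual => /=; ring. Qed.

(** The eps component of [qbinomial_mod]: since [1 - x = - eps], the sum enters with sign -1 and
    without the powers of [x], while [x ^+ M] contributes the multiple [M]. *)
Lemma tail_qbinomial p a M
    (u := fun n => \prod_(i < n) ((1 - a * p ^+ i) / (1 - p ^+ i.+1))) :
  (forall j, 1 - p ^+ j.+1 \is a GRing.unit) ->
  (forall j, 1 - a * p ^+ j \is a GRing.unit) ->
  eqmod (p ^+ M) (u M *+ M - \sum_(n < M) u n)
    (u M * \sum_(i < M) (p ^+ i.+1 / (1 - p ^+ i.+1) - a * p ^+ i / (1 - a * p ^+ i))).
Proof.
move=> p_unit a_unit.
have uE n : \prod_(i < n) ((1 - dconst a * dconst p ^+ i) / (1 - dconst p ^+ i.+1)) =
    dlog (u n) 0.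
  transitivity (\prod_(i < n) dlog ((1 - a * p ^+ i) / (1 - p ^+ i.+1)) 0).
    apply: eq_bigr => i _.
    by rewrite !dconstX dconstM !dlog1B_const dlogV // dlogM subr0.
  by rewrite dlog_prod big1_eq.
have dp_unit j : 1 - dconst p ^+ j.+1 \is a GRing.unit.
  by rewrite dconstX dual_unitE; exact: p_unit.
have dx_unit j : 1 - x * dconst p ^+ j.+1 \is a GRing.unit.
  by rewrite dconstX dual_unitE /= mul1r.
have := @qbinomial_mod _ (dconst p) (dconst a) dp_unit x M dx_unit.
rewrite dconstX => /eqmod_dual[_].
have -> : \prod_(i < M) ((1 - dconst a * (x * dconst p ^+ i)) /
                         (1 - x * dconst p ^+ i.+1)) =
    dlog (u M) (\sum_(i < M)
      (p ^+ i.+1 / (1 - p ^+ i.+1) - a * p ^+ i / (1 - a * p ^+ i))).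
  rewrite -dlog_prod; apply: eq_bigr => i _.
  rewrite !dconstX mulrCA dconstM !dlog1B // dlogV // dlogM; congr dlog; ring.
congr eqmod.
under eq_bigr => n _ do rewrite uE dlogX dlogM.
rewrite uE dlogX dlogM dual_sum /=.
have -> : \sum_(i < M) u i * 1 ^+ i = \sum_(i < M) u i.
  by apply: eq_bigr => i _; rewrite expr1n mulr1.
by rewrite expr1n; ring.
Qed.

(* The truncated Rogers-Fine series at x = 1 + eps. *)
Definition rf_theta p a M : dual R :=
  \sum_(n < M)
    (\prod_(j < n) ((dconst a - x * dconst p ^+ j.+1) /
                    (1 - dconst a * (x * dconst p ^+ j.+1)))) *
    (x ^+ (2 * n) * dconst p ^+ (n ^ 2) * (1 - x ^+ 2 * dconst p ^+ (2 * n).+1)).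

(** Both components of [rogers_fine_mod]; the value component expresses [w M] as a theta series,
    which case (vi) needs. *)
Lemma tail_rogers_fine p a M
    (w := fun n => \prod_(i < n) ((1 - p ^+ i.+1) / (1 - a * p ^+ i.+1))) :
  (forall j, 1 - p ^+ j.+1 \is a GRing.unit) ->
  (forall j, 1 - a * p ^+ j.+1 \is a GRing.unit) ->
  eqmod (p ^+ M) (w M) (dval (rf_theta p a M)) /\
  eqmod (p ^+ M) (w M *+ M - \sum_(n < M) w n)
    (w M * \sum_(i < M) (p ^+ i.+1 / (1 - p ^+ i.+1)
                         - a * p ^+ i.+1 / (1 - a * p ^+ i.+1))
     + dder (rf_theta p a M)).
Proof.
move=> p_unit a_unit.
set C := \sum_(i < M) (_ - _).
have dx_unit j : 1 - dconst a * (x * dconst p ^+ j.+1) \is a GRing.unit.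
  by rewrite dconstX dual_unitE /= mul1r.
pose l i := - (p ^+ i.+1 / (1 - p ^+ i.+1)) + a * p ^+ i.+1 / (1 - a * p ^+ i.+1).
have wE n : x ^+ n * \prod_(i < n) ((1 - x * dconst p ^+ i.+1) /
      (1 - dconst a * (x * dconst p ^+ i.+1))) =
    dlog (w n) (n%:R + \sum_(i < n) l i).
  rewrite dlogX expr1n -[w n]mul1r -dlogM -dlog_prod.
  congr (_ * _); apply: eq_bigr => i _.
  rewrite !dconstX mulrCA dconstM !dlog1B // dlogV // dlogM; congr dlog.
  by rewrite opprK.
have := @rogers_fine_mod _ (dconst p) (dconst a) x M dx_unit.
rewrite -/(rf_theta p a M) dconstX.
under eq_bigr => n _ do rewrite wE.
rewrite wE dual_sum => /eqmod_dual[]; rewrite dvalD dderD dvalM dderM /=.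
(* The value of [1 - x] is 0, so the sum disappears from the value component and enters the eps
   component undifferentiated. *)
rewrite subrr !mul0r !add0r => Ev Ed; split=> //.
have -> : C = - \sum_(i < M) l i.
  by rewrite /C -sumrN; apply: eq_bigr => i _; rewrite /l opprD opprK.
have := eqmodD (eqmod_refl _ (w M * - \sum_(i < M) l i)) Ed.
by congr eqmod; ring.
Qed.

(** For beta = 0 the inner product is [(- x) ^+ n] times a triangular power of [p]. Combined with
    [n ^ 2] this gives the pentagonal exponents, and the power of [x] is the logarithmic
    derivative. *)
Lemma rf_theta0 p M : rf_theta p 0 M =
  \sum_(n < M) (dlog ((-1) ^+ n * p ^+ ((n * (3 * n + 1)) %/ 2)) (3 * n)%:R
     - dlog ((-1) ^+ n * p ^+ ((n.+1 * (3 * n + 2)) %/ 2)) (3 * n + 2)%:R).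
Proof.
apply: eq_bigr => n _.
have -> : \prod_(j < n) ((dconst 0 - x * dconst p ^+ j.+1) /
      (1 - dconst 0 * (x * dconst p ^+ j.+1))) =
    dlog ((-1) ^+ n * p ^+ ((n * n.+1) %/ 2)) n%:R.
  elim: (n : nat) => [|k IH].
    by rewrite big_ord0 mul0n div0n !expr0 mulr1 /dlog mulr0.
  rewrite big_ord_recr /= IH.
  have -> : (dconst 0 - x * dconst p ^+ k.+1) / (1 - dconst 0 * (x * dconst p ^+ k.+1))
      = dlog (- p ^+ k.+1) 1.
    have -> : dconst (0 : R) = 0 by [].
    rewrite mul0r subr0 divr1 sub0r dconstX; congr Dual => /=; ring.
  rewrite dlogM [(-1) ^+ k.+1]exprS -natr1; congr dlog.
  have -> : ((k.+1 * k.+2) %/ 2 = (k * k.+1) %/ 2 + k.+1)%N by lia.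
  by rewrite exprD; ring.
rewrite mulrBr mulr1 mulrBr; congr (_ - _).
  rewrite dlogX expr1n dconstX dlog0 !dlogM addr0 mul1r -mulrA -exprD; congr dlog.
    by congr (_ * p ^+ _); rewrite -mulnn; lia.
  by rewrite -natrD; congr _%:R; lia.
rewrite !dlogX !expr1n !dconstX !dlog0 !dlogM !addr0 !mul1r -!mulrA -!exprD; congr dlog.
  by congr (_ * p ^+ _); rewrite -mulnn; lia.
by rewrite -!natrD; congr _%:R; lia.
Qed.

(** For beta = -1 every factor of the inner product equals -1, so only squares remain as
    exponents. *)
Lemma rf_thetaN1 p M : (forall j, 1 + p ^+ j.+1 \is a GRing.unit) ->
  rf_theta p (-1) M =
  \sum_(n < M) (dlog ((-1) ^+ n * p ^+ (n ^ 2)) (2 * n)%:R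
     - dlog ((-1) ^+ n * p ^+ (n.+1 ^ 2)) (2 * n.+1)%:R).
Proof.
move=> p_unit; apply: eq_bigr => n _.
have -> : \prod_(j < n) ((dconst (-1) - x * dconst p ^+ j.+1) /
      (1 - dconst (-1) * (x * dconst p ^+ j.+1))) = dlog ((-1) ^+ n) 0.
  rewrite -dlog0 -dconstX -[in RHS](card_ord n) -prodr_const; apply: eq_bigr => j _.
  have -> : dconst (-1) = -1 :> dual R by congr Dual; rewrite /= oppr0.
  rewrite mulN1r opprK -opprD mulNr divrr // dconstX dual_unitE /= mul1r //.
rewrite mulrBr mulr1 mulrBr; congr (_ - _).
  by rewrite dlogX expr1n dconstX dlog0 !dlogM addr0 add0r mul1r.
rewrite !dlogX !expr1n !dconstX !dlog0 !dlogM !addr0 !add0r !mul1r -!exprD -!natrD.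
congr dlog.
  by congr (_ * p ^+ _); rewrite -!mulnn; lia.
by congr _%:R; lia.
Qed.

(** With base [q ^+ 2] and beta = [q] the inner product telescopes. Its last denominator cancels one
    factor of the difference of squares [1 - x ^+ 2 * q ^+ (4 * n + 2)], and the other factor yields
    the terms [m = 2 * n] and [m = 2 * n + 1]. *)
Lemma rf_theta_sqr q M : (forall j, 1 - q ^+ j.+1 \is a GRing.unit) ->
  rf_theta (q ^+ 2) q M =
  (1 - x * dconst q) *
  \sum_(0 <= m < M.*2) dlog (q ^+ ((m * m.+1) %/ 2)) m%:R.
Proof.
move=> q_unit; rewrite big_distrr /= /rf_theta.
have dx_unit j : 1 - x * dconst (q ^+ j.+1) \is a GRing.unit.
  by rewrite dual_unitE /= mul1r.
elim: M => [|n IH]; first by rewrite big_ord0 big_geq.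
rewrite big_ord_recr IH doubleS !big_nat_recr //= -addrA; congr (_ + _).
have -> : \prod_(j < n) ((dconst q - x * dconst (q ^+ 2) ^+ j.+1) /
      (1 - dconst q * (x * dconst (q ^+ 2) ^+ j.+1))) =
    dconst (q ^+ n) * ((1 - x * dconst q) / (1 - x * dconst (q ^+ (2 * n).+1))).
  elim: (n) => [|k IHk]; first by rewrite big_ord0 mul1r divrr // (dx_unit 0%N).
  rewrite big_ord_recr /= IHk.
  have -> : dconst q - x * dconst (q ^+ 2) ^+ k.+1 =
      dconst q * (1 - x * dconst (q ^+ (2 * k).+1)).
    by rewrite mulrBr mulr1 mulrCA dconstM !dconstX -exprM -exprS mulnS.
  have -> : dconst q * (x * dconst (q ^+ 2) ^+ k.+1) = x * dconst (q ^+ (2 * k.+1).+1).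
    by rewrite mulrCA dconstX -exprM dconstM -exprS.
  rewrite -mulrA -[X in _ * X]mulrA [X in _ * (_ * X)]mulrA.
  rewrite [X in _ * (_ * (X / _))]mulrCA mulVr // mulr1.
  rewrite [q ^+ k.+1]exprSr -[dconst (_ * q)]dconstM; ring.
have -> : 1 - x ^+ 2 * dconst (q ^+ 2) ^+ (2 * n).+1 =
    (1 - x * dconst (q ^+ (2 * n).+1)) * (1 + x * dconst (q ^+ (2 * n).+1)).
  rewrite dconstX -exprM mulnC exprM -dconstX; ring.
rewrite [LHS](_ : _ = (1 - x * dconst q) *
   ((1 - x * dconst (q ^+ (2 * n).+1))^-1 * (1 - x * dconst (q ^+ (2 * n).+1))) *
   (dconst (q ^+ n) * (x ^+ (2 * n) * dconst (q ^+ 2) ^+ (n ^ 2)) *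
    (1 + x * dconst (q ^+ (2 * n).+1)))); last by ring.
rewrite mulVr // mulr1 -mulrDr; congr (_ * _); rewrite mulrDr mulr1.
have E : dconst (q ^+ n) * (x ^+ (2 * n) * dconst (q ^+ 2) ^+ (n ^ 2)) =
    dlog (q ^+ ((n.*2 * n.*2.+1) %/ 2)) (n.*2)%:R.
  rewrite dconstX dlogX !dlog0 !dlogM add0r addr0 expr1n mul1r -exprM -exprD -mul2n.
  by congr dlog; congr (q ^+ _); rewrite -mulnn; lia.
congr (_ + _); first exact: E.
rewrite E dlog0 !dlogM addr0 mul1r natr1 -exprD; congr dlog.
by congr (q ^+ _); lia.
Qed.
End Tails.

(** * Limits in Z[[q]] *)

Lemma coef_fpsqM (f : fps) n : (q * f) n = if n is m.+1 then f m else 0.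
Proof.
rewrite coef_fpsM big_ord_recl mul0r add0r.
case: n => [|n]; first by rewrite big_ord0.
rewrite big_ord_recl lift0 mul1r subSS subn0 big1 ?addr0 // => i _.
by rewrite !lift0 mul0r.
Qed.

(** Links congruences to the basic q-adic neighbourhoods. The cofactor is built by shifting
    coefficients, one factor [q] at a time. *)
Lemma eqmod_qP n (f g : fps) :
  eqmod (q ^+ n) f g <-> forall i, (i < n)%N -> f i = g i.
Proof.
split=> [[h ->] i|].
  elim: n i h => // n IH i h; rewrite exprS -mulrA coef_fpsD coef_fpsqM.
  case: i => [|i]; first by rewrite addr0.
  rewrite ltnS => /(IH i h); rewrite coef_fpsD => /(canRL (addKr _)).
  by rewrite addNr => ->; rewrite addr0.
elim: n f g => [|n IH] f g fg; first by rewrite expr0; exact: eqmod1.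
have [h hE] := IH (Fps (fun i => f i.+1)) (Fps (fun i => g i.+1))
  (fun i i_n => fg i.+1 i_n).
exists h; rewrite exprS -mulrA; apply/fpsP => -[|i].
  by rewrite coef_fpsD coef_fpsqM addr0 fg.
by rewrite coef_fpsD coef_fpsqM; have /fpsP/(_ i) := hE.
Qed.

Lemma fps_cvg_eqmod (u : nat -> fps) :
  (forall n, eqmod (q ^+ n) (u n.+1) (u n)) ->
  cvgn u /\ forall n, eqmod (q ^+ n) (limn u) (u n).
Proof.
move=> uS.
have le m n : (m <= n)%N -> eqmod (q ^+ m) (u n) (u m).
  move=> /subnKC <-; elim: (n - m)%N => [|k IH].
    rewrite addn0; exact: eqmod_refl.
  rewrite addnS; apply: eqmod_trans IH.
  exact: eqmod_exp_leq (leq_addr k m) (uS _).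
(* Coefficient [n] is constant from index [n.+1] on, so the limit is read off the diagonal. *)
pose l := Fps (fun n => u n.+1 n).
have ul : (u @ \oo --> l)%classic.
  apply/fps_cvgP => n; exists n.+1 => N nN.
  by move/eqmod_qP: (le _ _ nN); apply.
split; first by apply/cvg_ex; exists l.
rewrite (cvg_lim fps_hausdorff ul) => n; apply/eqmod_qP => i i_n.
by move/eqmod_qP: (le _ _ i_n) => /(_ i) ->.
Qed.

Lemma fps_prod_cvg (b : nat -> fps) :
  (forall j, eqmod (q ^+ j.+1) (b j.+1) 1) ->
  multipliable_from 1 b /\
  forall N, eqmod (q ^+ N.+1) (\prod_(1 <= j <oo) b j) (\prod_(i < N) b i.+1).
Proof.
move=> b1; have [|cb lb] := @fps_cvg_eqmod (fun n => \prod_(1 <= i < n) b i).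
  case=> [|n]; first by rewrite expr0; exact: eqmod1.
  rewrite big_nat_recr //= -[X in eqmod _ _ X]mulr1; exact: eqmodMl.
split=> // N; by have := lb N.+1; rewrite big_add1 big_mkord.
Qed.

Lemma fps_sum_cvg (c : nat -> fps) :
  (forall d, eqmod (q ^+ d.+1) (c d.+1) 0) ->
  summable_from 1 c /\
  forall N, eqmod (q ^+ N.+1) (\sum_(1 <= d <oo) c d) (\sum_(i < N) c i.+1).
Proof.
move=> c0; have [|cc lc] := @fps_cvg_eqmod (fun n => \sum_(1 <= i < n) c i).
  case=> [|n]; first by rewrite expr0; exact: eqmod1.
  rewrite big_nat_recr //= -[X in eqmod _ _ X]addr0.
  by apply: eqmodD => //; exact: eqmod_refl.
split=> // N; by have := lc N.+1; rewrite big_add1 big_mkord.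
Qed.

Lemma fps_eqmod_eq (f g : fps) : (forall n, eqmod (q ^+ n) f g) -> f = g.
Proof. by move=> fg; apply/fpsP => n; have /eqmod_qP := fg n.+1; apply. Qed.

(** The left side of the last hypothesis is the [M]-th partial sum of tails with the infinite
    product replaced by [B M], which is harmless modulo [q ^+ M]. The tails themselves tend to 0
    q-adically, so their sum converges. *)
Lemma tail_identity_eqmod (b c : nat -> fps) (G : fps)
    (B := fun n => \prod_(i < n) b i.+1) :
  (forall j, eqmod (q ^+ j.+1) (b j.+1) 1) ->
  (forall d, eqmod (q ^+ d.+1) (c d.+1) 0) ->
  (forall M, eqmod (q ^+ M) (B M *+ M - \sum_(n < M) B n)
                            (B M * (\sum_(i < M) c i.+1) + G)) ->
  tail_identity b c G.
Proof.
move=> /fps_prod_cvg[mb lb] /fps_sum_cvg[sc lc] BE.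
have tailE N : tail b N = \prod_(1 <= j <oo) b j - B N.
  by rewrite /tail big_add1 big_mkord.
have [|st lt] := @fps_cvg_eqmod (fun n => \sum_(0 <= i < n) tail b i).
  move=> n; rewrite big_nat_recr //= -[X in eqmod _ _ X]addr0.
  apply: eqmodD; first exact: eqmod_refl.
  rewrite tailE -[X in eqmod _ _ X](subrr (B n)).
  by apply: eqmodD; [exact: eqmod_exp_leq (leqnSn n) (lb n)|exact: eqmod_refl].
split=> //; apply: fps_eqmod_eq => M.
apply: eqmod_trans (lt M) _.
have lbM := eqmod_exp_leq (leqnSn M) (lb M).
have lcM := eqmod_exp_leq (leqnSn M) (lc M).
rewrite big_mkord; under eq_bigr => N _ do rewrite tailE.
rewrite sumrB sumr_const card_ord -mulr_natr.
apply: eqmod_trans (eqmodD (eqmodM lbM (eqmod_refl _ _)) (eqmod_refl _ _)) _.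
rewrite mulr_natr; apply: eqmod_trans (BE M) _.
by apply: eqmodD (eqmod_refl _ _); apply: eqmodM; apply: eqmod_sym.
Qed.

Lemma unit_1Bq (f : fps) : f 0%N = 0 -> 1 - f \is a GRing.unit.
Proof. by move=> f0; rewrite fps_unitE coef_fpsB f0 subr0 coef_fps1. Qed.

Lemma coef0_qS j : (q ^+ j.+1) 0%N = 0.
Proof. exact: coef_fpsX_lt. Qed.

(** * The six identities *)

Lemma coef0_fpsM (f g : fps) : (f * g) 0%N = f 0%N * g 0%N.
Proof. by rewrite coef_fpsM big_ord1. Qed.

(** The base is a positive power of [q], so congruences modulo [p ^+ M] weaken to [q ^+ M]. The sums
    are compared only modulo [q ^+ M] because [M] factors may yield more than [M] Lambert terms, as
    in case (iii). *)
Lemma tail_identity_qbinomial (e : nat) (a : fps) (b c : nat -> fps)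
    (p := q ^+ e.+1) :
  a 0%N = 0 ->
  (forall i, b i.+1 = (1 - a * p ^+ i) / (1 - p ^+ i.+1)) ->
  (forall j, eqmod (q ^+ j.+1) (b j.+1) 1) ->
  (forall d, eqmod (q ^+ d.+1) (c d.+1) 0) ->
  (forall M, eqmod (q ^+ M)
     (\sum_(i < M) (p ^+ i.+1 / (1 - p ^+ i.+1) - a * p ^+ i / (1 - a * p ^+ i)))
     (\sum_(i < M) c i.+1)) ->
  tail_identity b c 0.
Proof.
move=> a0 bE b1 c0 cE; apply: tail_identity_eqmod => // M.
 have p_unit j : 1 - p ^+ j.+1 \is a GRing.unit.
  by apply: unit_1Bq; apply: coef_fpsX_lt => //; exact: coef0_qS.
have a_unit j : 1 - a * p ^+ j \is a GRing.unit.
  by apply: unit_1Bq; rewrite coef0_fpsM a0 mul0r.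
have BE n : \prod_(i < n) b i.+1 = \prod_(i < n) ((1 - a * p ^+ i) / (1 - p ^+ i.+1)).
  exact: eq_bigr.
under [\sum_(n < M) _]eq_bigr => n _ do rewrite BE.
have := tail_qbinomial M p_unit a_unit.
rewrite -exprM mulSn => /eqmod_exp_leq-/(_ _ (leq_addr _ _)) H.
rewrite BE addr0; apply: eqmod_trans H _; exact: eqmodMl.
Qed.

(** The theta evaluation of the product is handed to the last hypothesis, where case (vi) uses it to
    trade the product for a series. *)
Lemma tail_identity_rogers_fine (e : nat) (a : fps) (b c : nat -> fps) (G : fps)
    (p := q ^+ e.+1) :
  (forall i, b i.+1 = (1 - p ^+ i.+1) / (1 - a * p ^+ i.+1)) ->
  (forall j, eqmod (q ^+ j.+1) (b j.+1) 1) ->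
  (forall d, eqmod (q ^+ d.+1) (c d.+1) 0) ->
  (forall M, eqmod (q ^+ M) (\prod_(i < M) b i.+1) (dval (rf_theta p a M)) ->
     eqmod (q ^+ M)
     ((\prod_(i < M) b i.+1) *
        (\sum_(i < M) (p ^+ i.+1 / (1 - p ^+ i.+1)
                       - a * p ^+ i.+1 / (1 - a * p ^+ i.+1)))
      + dder (rf_theta p a M))
     ((\prod_(i < M) b i.+1) * (\sum_(i < M) c i.+1) + G)) ->
  tail_identity b c G.
Proof.
move=> bE b1 c0 cE; apply: tail_identity_eqmod => // M.
 have p_unit j : 1 - p ^+ j.+1 \is a GRing.unit.
  by apply: unit_1Bq; apply: coef_fpsX_lt => //; exact: coef0_qS.
have a_unit j : 1 - a * p ^+ j.+1 \is a GRing.unit.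
  apply: unit_1Bq; rewrite coef0_fpsM (coef_fpsX_lt (k := j.+1)) ?mulr0 //.
  exact: coef0_qS.
have BE n : \prod_(i < n) b i.+1 =
    \prod_(i < n) ((1 - p ^+ i.+1) / (1 - a * p ^+ i.+1)).
  exact: eq_bigr.
have [] := tail_rogers_fine M p_unit a_unit.
rewrite -exprM mulSn => /eqmod_exp_leq-/(_ _ (leq_addr _ _)) Hv.
move=> /eqmod_exp_leq-/(_ _ (leq_addr _ _)) Hd.
under [\sum_(n < M) _]eq_bigr => n _ do rewrite BE.
apply: eqmod_trans (cE M _); rewrite BE; [exact: Hd|exact: Hv].
Qed.

Lemma sum_divr_1B_1D (R : comUnitRingType) (y : R) :
  1 - y \is a GRing.unit -> 1 + y \is a GRing.unit ->
  y / (1 - y) + y / (1 + y) = 2 * y / (1 - y ^+ 2).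
Proof.
move=> um up; have -> : 1 - y ^+ 2 = (1 + y) * (1 - y) by ring.
rewrite invrM //; move: (mulVr um) (mulVr up).
set u := (1 - y)^-1; set v := (1 + y)^-1 => hu hv.
(* Multiplying by [v * (1 + y) = 1] and [u * (1 - y) = 1] creates the common denominator, with the
   inverses kept as atoms for [ring]. *)
have -> : y * u + y * v = y * u * (v * (1 + y)) + y * v * (u * (1 - y)).
  by rewrite hu hv !mulr1.
ring.
Qed.

Lemma eqmod_lambert (s : nat -> fps) d :
  eqmod (q ^+ d.+1) (s d.+1 * q ^+ d.+1 / (1 - q ^+ d.+1)) 0.
Proof. by exists (s d.+1 / (1 - q ^+ d.+1)); ring. Qed.

Lemma eqmod_lambert2 d :
  eqmod (q ^+ d.+1) (2 * q ^+ d.+1 / (1 - q ^+ (2 * d.+1))) 0.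
Proof. by exists (2 / (1 - q ^+ (2 * d.+1))); ring. Qed.

Lemma unit_1Bq_exp n : (0 < n)%N -> 1 - q ^+ n \is a GRing.unit.
Proof. by case: n => // n _; apply: unit_1Bq; exact: coef0_qS. Qed.

Lemma unit_1Dq_exp n : (0 < n)%N -> 1 + q ^+ n \is a GRing.unit.
Proof.
case: n => // n _; rewrite -[q ^+ _]opprK; apply: unit_1Bq.
by rewrite coef_fpsN coef0_qS oppr0.
Qed.

Lemma fps_sum_cvg_leq (c : nat -> fps) M N : (M <= N)%N ->
  (forall d, eqmod (q ^+ d.+1) (c d.+1) 0) ->
  eqmod (q ^+ M) (\sum_(i < N) c i.+1) (\sum_(1 <= d <oo) c d).
Proof.
move=> MN /fps_sum_cvg[_ /(_ N) H]; apply: eqmod_sym.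
exact: eqmod_exp_leq (leqW MN) H.
Qed.

Definition lambert_alt d : fps := (-1) ^+ d * q ^+ d / (1 - q ^+ d).

(** Both partial sums agree with the infinite sum modulo [q ^+ M]. This absorbs the surplus when [M]
    factors give [2 * M] terms in (iii) and terms up to [2 * M + 1] in (vi). *)
Lemma sum_lambert_alt M N : (M <= N)%N ->
  eqmod (q ^+ M) (\sum_(i < N) lambert_alt i.+1) (\sum_(i < M) lambert_alt i.+1).
Proof.
have c0 d : eqmod (q ^+ d.+1) (lambert_alt d.+1) 0.
  exact: (eqmod_lambert (fun d => (-1) ^+ d)).
move=> MN; apply: eqmod_trans (fps_sum_cvg_leq MN c0) _.
exact: eqmod_sym (fps_sum_cvg_leq (leqnn M) c0).
Qed.

Lemma tail_identity_i :
  tail_identity (fun j => 1 / (1 - q ^+ j)) (fun d => q ^+ d / (1 - q ^+ d)) 0.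
Proof.
apply: (@tail_identity_qbinomial 0 0) => //.
- by move=> i; rewrite mul0r subr0 expr1.
- move=> j; apply: eqmod_div1; first exact: unit_1Bq_exp.
  by exists 1; ring.
- move=> d; have := eqmod_lambert (fun=> 1) d; by rewrite mul1r.
- move=> M; rewrite [X in eqmod _ X](_ : _ = \sum_(i < M) q ^+ i.+1 / (1 - q ^+ i.+1)).
    exact: eqmod_refl.
  by apply: eq_bigr => i _; rewrite expr1 !mul0r subr0.
Qed.

Lemma tail_identity_ii :
  tail_identity (fun j => (1 + q ^+ j) / (1 - q ^+ j))
                (fun d => 2 * q ^+ d / (1 - q ^+ (2 * d))) 0.
Proof.
apply: (@tail_identity_qbinomial 0 (- q)).
- by rewrite coef_fpsN.
- by move=> i; rewrite expr1 mulNr opprK -exprS.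
- move=> j; apply: eqmod_div1; first exact: unit_1Bq_exp.
  by exists 2; ring.
- exact: eqmod_lambert2.
- move=> M; rewrite [X in eqmod _ X](_ : _ =
      \sum_(i < M) 2 * q ^+ i.+1 / (1 - q ^+ (2 * i.+1))); first exact: eqmod_refl.
  apply: eq_bigr => i _; rewrite expr1 !mulNr !opprK -exprS.
  by rewrite sum_divr_1B_1D ?unit_1Bq_exp ?unit_1Dq_exp // -exprM mulnC.
Qed.

Lemma tail_identity_iii :
  tail_identity (fun j => (1 - q ^+ (2 * j - 1)) / (1 - q ^+ (2 * j)))
                (fun d => (-1) ^+ d * q ^+ d / (1 - q ^+ d)) 0.
Proof.
apply: (@tail_identity_qbinomial 1 q) => //.
- by move=> i; rewrite -!exprM -exprS mulnS.
- move=> j; apply: eqmod_div1; first exact: unit_1Bq_exp.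
  have -> : (2 * j.+1 - 1 = j.+1 + j)%N by lia.
  have -> : (2 * j.+1 = j.+1 + j.+1)%N by lia.
  by rewrite !exprD; apply: eqmod_trans (eqmod_1B _ _) (eqmod_sym (eqmod_1B _ _)).
- exact: (eqmod_lambert (fun d => (-1) ^+ d)).
- move=> M; rewrite [X in eqmod _ X](_ : _ = \sum_(i < M.*2) lambert_alt i.+1).
    by apply: sum_lambert_alt; rewrite -addnn leq_addr.
  (* Each denominator gives an even-indexed term with sign +, each numerator an odd-indexed one with
     sign -. *)
  elim: M => [|M IH]; first by rewrite !big_ord0.
  rewrite doubleS !big_ord_recr /= IH -addrA; congr (_ + _).
  rewrite /lambert_alt -!exprM -exprS mulnS -mul2n !exprS.
  by rewrite -signr_odd mul2n odd_double expr0; ring.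
Qed.

Lemma tail_identity_iv :
  let g r := (-1) ^+ r * ((3 * r - 1)%N%:R * q ^+ ((r * (3 * r - 1)) %/ 2)
                           + (3 * r)%N%:R * q ^+ ((r * (3 * r + 1)) %/ 2)) in
  summable_from 1 g /\
  tail_identity (fun j => 1 - q ^+ j) (fun d => q ^+ d / (1 - q ^+ d))
                (\sum_(1 <= r <oo) g r).
Proof.
move=> g.
have g0 d : eqmod (q ^+ d.+1) (g d.+1) 0.
  have -> : ((0 : fps) = (-1) ^+ d.+1 * (0 + 0))%R by rewrite addr0 mulr0.
  apply: eqmodMl; apply: eqmodD; rewrite mulrC; apply: eqmodX0; nia.
split; first exact: (fps_sum_cvg g0).1.
apply: (@tail_identity_rogers_fine 0 0).
- by move=> i; rewrite mul0r subr0 divr1 expr1.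
- by move=> j; exists (-1); ring.
- move=> d; have := eqmod_lambert (fun=> 1) d; by rewrite mul1r.
move=> M _; apply: eqmodD.
  apply: eqmodMl.
  rewrite [X in eqmod _ X](_ : _ = \sum_(i < M) q ^+ i.+1 / (1 - q ^+ i.+1)).
    exact: eqmod_refl.
  by apply: eq_bigr => i _; rewrite expr1 !mul0r subr0.
apply: eqmod_trans (fps_sum_cvg_leq (leqnn M) g0).
rewrite expr1 rf_theta0.
(* The negative part of index [r - 1] joins the positive part of index [r] to form [g r]. The
   positive part vanishes at index 0, and the one at index [M] is missing, whence the correction. *)
have -> : dder (\sum_(n < M)
    (dlog ((-1) ^+ n * q ^+ ((n * (3 * n + 1)) %/ 2)) (3 * n)%:R
     - dlog ((-1) ^+ n * q ^+ ((n.+1 * (3 * n + 2)) %/ 2)) (3 * n + 2)%:R)) =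
   \sum_(i < M) g i.+1 - q ^+ ((M * (3 * M + 1)) %/ 2) * ((-1) ^+ M * (3 * M)%:R).
  elim: M => [|M IH]; first by rewrite !big_ord0 muln0 !mulr0 subr0.
  rewrite !big_ord_recr dderD IH /= /g exprS.
  have -> : (3 * M.+1 - 1 = 3 * M + 2)%N by lia.
  by ring.
rewrite -[X in eqmod _ _ X]subr0; apply: eqmodD; first exact: eqmod_refl.
by apply: eqmodN; apply: eqmodX0; nia.
Qed.

Lemma tail_identity_v :
  let g r := (-1) ^+ r * r%:R * q ^+ (r ^ 2) in
  summable_from 1 g /\
  tail_identity (fun j => (1 - q ^+ j) / (1 + q ^+ j))
                (fun d => 2 * q ^+ d / (1 - q ^+ (2 * d)))
                (4 * \sum_(1 <= r <oo) g r).
Proof.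
move=> g.
have g0 d : eqmod (q ^+ d.+1) (g d.+1) 0.
  by rewrite /g mulrC; apply: eqmodX0; rewrite -mulnn leq_pmulr.
split; first exact: (fps_sum_cvg g0).1.
apply: (@tail_identity_rogers_fine 0 (-1)).
- by move=> i; rewrite expr1 mulN1r opprK.
- move=> j; apply: eqmod_div1; first exact: unit_1Dq_exp.
  by exists (- 2); ring.
- exact: eqmod_lambert2.
move=> M _; apply: eqmodD.
  apply: eqmodMl; rewrite [X in eqmod _ X](_ : _ =
      \sum_(i < M) 2 * q ^+ i.+1 / (1 - q ^+ (2 * i.+1))); first exact: eqmod_refl.
  apply: eq_bigr => i _; rewrite expr1 !mulN1r mulNr !opprK.
  by rewrite sum_divr_1B_1D ?unit_1Bq_exp ?unit_1Dq_exp // -exprM mulnC.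
apply: eqmod_trans (eqmodMl 4 (fps_sum_cvg_leq (leqnn M) g0)).
rewrite expr1 rf_thetaN1; last by move=> j; exact: unit_1Dq_exp.
(* The same regrouping: two contributions [2 * r] to each square give the factor 4, with the
   positive part of index [M] missing. *)
have -> : dder (\sum_(n < M) (dlog ((-1) ^+ n * q ^+ (n ^ 2)) (2 * n)%:R
     - dlog ((-1) ^+ n * q ^+ (n.+1 ^ 2)) (2 * n.+1)%:R)) =
   4 * (\sum_(i < M) g i.+1) - q ^+ (M ^ 2) * ((-1) ^+ M * (2 * M)%:R).
  elim: M => [|M IH]; first by rewrite !big_ord0 muln0 !mulr0 subr0.
  by rewrite !big_ord_recr dderD IH /= /g exprS !natrM; ring.
rewrite -[X in eqmod _ _ X]subr0; apply: eqmodD; first exact: eqmod_refl.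
by apply: eqmodN; apply: eqmodX0; nia.
Qed.

Lemma tail_identity_vi :
  let g r := r%:R * q ^+ ((r * (r + 1)) %/ 2) in
  summable_from 1 g /\
  tail_identity (fun j => (1 - q ^+ (2 * j)) / (1 - q ^+ (2 * j + 1)))
                (fun d => (-1) ^+ d * q ^+ d / (1 - q ^+ d))
                ((1 - q) * \sum_(1 <= r <oo) g r).
Proof.
move=> g.
have g0 d : eqmod (q ^+ d.+1) (g d.+1) 0.
  by rewrite /g mulrC; apply: eqmodX0; nia.
split; first exact: (fps_sum_cvg g0).1.
apply: (@tail_identity_rogers_fine 1 q).
- by move=> i; rewrite -!exprM -exprS addn1.
- move=> j; apply: eqmod_div1; first by apply: unit_1Bq_exp; rewrite addn1.
  have -> : (2 * j.+1 + 1 = j.+1 + j.+2)%N by lia.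
  have -> : (2 * j.+1 = j.+1 + j.+1)%N by lia.
  by rewrite !exprD; apply: eqmod_trans (eqmod_1B _ _) (eqmod_sym (eqmod_1B _ _)).
- exact: (eqmod_lambert (fun d => (-1) ^+ d)).
move=> M.
have uq : 1 - q \is a GRing.unit by exact: (@unit_1Bq_exp 1).
set B := \prod_(i < M) _; set S := \sum_(0 <= m < M.*2) q ^+ ((m * m.+1) %/ 2).
have thE : rf_theta (q ^+ 2) q M = (1 - dlog 1 1 * dconst q) *
    Dual S (\sum_(0 <= m < M.*2) q ^+ ((m * m.+1) %/ 2) * m%:R).
  rewrite rf_theta_sqr; last by move=> j; exact: unit_1Bq_exp.
  by rewrite dual_sum.
rewrite thE dvalM dderM /= => BS.
(* The logarithmic derivative starts at [d = 2]; adding the term [d = 1], which is [- q / (1 - q)],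
   must be compensated. *)
rewrite [X in B * X](_ : _ = \sum_(i < M.*2.+1) lambert_alt i.+1
  + q / (1 - q)); last first.
  elim: (M) => [|k IH].
    by rewrite big_ord0 big_ord1 /lambert_alt expr1; ring.
  rewrite doubleS big_ord_recr /= IH.
  have -> : \sum_(i < k.*2.+3) lambert_alt i.+1 =
      \sum_(i < k.*2.+1) lambert_alt i.+1 + lambert_alt k.*2.+2 + lambert_alt k.*2.+3.
    by rewrite 2!big_ord_recr.
  rewrite /lambert_alt -!exprM -!exprS mulnS mul2n !add2n.
  rewrite -(signr_odd _ k.*2.+3) -(signr_odd _ k.*2.+2) /= !negbK odd_double; ring.
have gS : eqmod (q ^+ M) (\sum_(0 <= m < M.*2) q ^+ ((m * m.+1) %/ 2) * m%:R)
    (\sum_(1 <= r <oo) g r).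
  have M2 : (M <= M.*2)%N by rewrite -addnn leq_addr.
  apply: eqmod_trans (fps_sum_cvg_leq M2 g0).
  (* The ranges are 1 to [M.*2] and 0 to [M.*2 - 1]; the term at 0 vanishes. *)
  have gE : \sum_(i < M.*2) g i.+1 =
      \sum_(0 <= m < M.*2) q ^+ ((m * m.+1) %/ 2) * m%:R + g M.*2.
    rewrite -(big_mkord xpredT (fun i => g i.+1)).
    elim: (M.*2) => [|k IH]; first by rewrite !big_geq // /g mul0r addr0.
    rewrite !big_nat_recr //= IH; congr (_ + _ + _).
    by rewrite /g addn1 mulrC.
  rewrite gE -[X in eqmod _ X]addr0; apply: eqmodD; first exact: eqmod_refl.
  by apply: eqmod_sym; rewrite /g mulrC; apply: eqmodX0; nia.
have M2 : (M <= M.*2.+1)%N by rewrite -addnn ltnW // ltnS leq_addr.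
(* By [BS], [B * (q / (1 - q))] is congruent to [q * S], which cancels the [- q * S] coming from the
   derivative of the prefactor [1 - x * q]. *)
have := eqmodD (eqmodD (eqmodMl B (sum_lambert_alt M2)) (eqmodMl (1 - q) gS))
  (eqmodM (eqmodD BS (eqmodN (eqmod_refl _ ((1 - q) * S))))
    (eqmod_refl _ (q / (1 - q)))).
have Sq : (1 - q) * S * (q / (1 - q)) = q * S.
  by rewrite mulrC mulrA divrK // mulrC.
congr eqmod; last by ring.
by rewrite [(B - _) * _]mulrBl Sq; ring.
Qed.

Theorem theorem1 :
  (* (i) *)
  tail_identity (fun j => 1 / (1 - q ^+ j))
                (fun d => q ^+ d / (1 - q ^+ d))
                0
  /\
  (* (ii) *)
  tail_identity (fun j => (1 + q ^+ j) / (1 - q ^+ j))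
                (fun d => 2 * q ^+ d / (1 - q ^+ (2 * d)))
                0
  /\
  (* (iii) *)
  tail_identity (fun j => (1 - q ^+ (2 * j - 1)) / (1 - q ^+ (2 * j)))
                (fun d => (-1) ^+ d * q ^+ d / (1 - q ^+ d))
                0
  /\
  (* (iv) *)
  (let g r := (-1) ^+ r * ((3 * r - 1)%N%:R * q ^+ ((r * (3 * r - 1)) %/ 2)
                           + (3 * r)%N%:R * q ^+ ((r * (3 * r + 1)) %/ 2)) in
   summable_from 1 g /\
   tail_identity (fun j => 1 - q ^+ j)
                 (fun d => q ^+ d / (1 - q ^+ d))
                 (\sum_(1 <= r <oo) g r))
  /\
  (* (v) *)
  (let g r := (-1) ^+ r * r%:R * q ^+ (r ^ 2) in
   summable_from 1 g /\
   tail_identity (fun j => (1 - q ^+ j) / (1 + q ^+ j))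
                 (fun d => 2 * q ^+ d / (1 - q ^+ (2 * d)))
                 (4 * \sum_(1 <= r <oo) g r))
  /\
  (* (vi) *)
  (let g r := r%:R * q ^+ ((r * (r + 1)) %/ 2) in
   summable_from 1 g /\
   tail_identity (fun j => (1 - q ^+ (2 * j)) / (1 - q ^+ (2 * j + 1)))
                 (fun d => (-1) ^+ d * q ^+ d / (1 - q ^+ d))
                 ((1 - q) * \sum_(1 <= r <oo) g r)).
Proof.
split; first exact: tail_identity_i.
split; first exact: tail_identity_ii.
split; first exact: tail_identity_iii.
split; first exact: tail_identity_iv.
split; first exact: tail_identity_v.
exact: tail_identity_vi.
Qed.
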